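(* For every prime $p$ there exists a group $Y$ of order $p^9$ such that $\mathcal{CD}(Y)$ is a quasi-antichain of width $p + 1$ and such that: if $p = 2$ then exactly one of the three atoms of $\mathcal{CD}(Y)$ is abelian; and if $p$ is odd then exactly two of the $p + 1$ atoms of $\mathcal{CD}(Y)$ are abelian.
   Context: For a finite group $G$ and a subgroup $U \leq G$, the Chermak-Delgado measure of $U$ in $G$ is $m_G(U) = |U|\,|C_G(U)|$. Let $m^*(G)$ be the maximum of $m_G(U)$ over all subgroups $U \leq G$. The Chermak-Delgado lattice of $G$ is $\mathcal{CD}(G) = \{U \leq G : m_G(U) = m^*(G)\}$, ordered by inclusion (it is a sublattice of the subgroup lattice of $G$). A lattice is a quasi-antichain if it consists of a maximum, a minimum, and the atoms of the lattice (the atoms being distinct from the maximum and minimum, and pairwise incomparable); its width is the number of atoms. *)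

(* Defs.v *)
From mathcomp Require Import all_boot all_fingroup.

Set Implicit Arguments.
Unset Strict Implicit.
Unset Printing Implicit Defensive.

Definition cd_measure (gT : finGroupType) (G U : {group gT}) : nat :=
  (#|U| * #|'C_G(U)%g|)%N.

Definition cd_max (gT : finGroupType) (G : {group gT}) : nat :=
  \max_(U : {group gT} | U \subset G) cd_measure G U.

Definition cd_lattice (gT : finGroupType) (G : {group gT}) : {set {group gT}} :=
  [set U : {group gT} | (U \subset G) && (cd_measure G U == cd_max G)].

Definition is_maximum (gT : finGroupType) (L : {set {group gT}})
    (M : {group gT}) : bool :=
  (M \in L) && [forall H in L, (H : {group gT}) \subset M].

Definition is_minimum (gT : finGroupType) (L : {set {group gT}})
    (B : {group gT}) : bool :=
  (B \in L) && [forall H in L, B \subset (H : {group gT})].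

Definition atoms (gT : finGroupType) (L : {set {group gT}}) :
    {set {group gT}} :=
  [set A in L | [exists B : {group gT},
     [&& is_minimum L B, B \proper (A : {group gT})
       & [forall H in L, ~~ ((B \proper (H : {group gT})) && (H \proper A))]]]].

(* [M \notin atoms L] excludes the two-element chain, whose maximum would be
   an atom; the minimum is never an atom, and atoms are pairwise incomparable. *)
Definition quasi_antichain (gT : finGroupType) (L : {set {group gT}}) : Prop :=
  exists M B : {group gT},
    [/\ is_maximum L M, is_minimum L B, M \notin atoms L
      & L = M |: (B |: atoms L)].

Definition quasi_antichain_of_width (gT : finGroupType)
    (L : {set {group gT}}) (w : nat) : Prop :=
  quasi_antichain L /\ #|atoms L| = w.

Definition abelian_atoms (gT : finGroupType) (L : {set {group gT}}) :
    {set {group gT}} :=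
  [set A in atoms L | abelian (A : {group gT})].

(* Main.v *)
From HB Require Import structures.
Require Import Defs.
From mathcomp Require Import all_boot all_fingroup.
From mathcomp Require Import all_algebra ring.

Set Implicit Arguments.
Unset Strict Implicit.
Unset Printing Implicit Defensive.

(** Let F be a finite field with q elements and W = F^3 with its cross product.
    Put the bilinear symmetric form s(u, u') = a a' - b b' on F^2 and consider
    the alternating map
       beta (w (x) u, w' (x) u') = s(u, u') (w x w')
    from W (x) F^2 to W, where w x w' is the cross product.  It is the commutator
    map of a group Y of nilpotency class two and order q^9, written here as
    triples (x, y, z) of vectors of W, where (x, y) stands for
    x (x) e1 + y (x) e2; thus two elements commute iff cross x x' = cross y y'
    ([commuteP]).  Equivalently, Y is a central product of two copies of a group
    of order q^6 whose centre and central quotient are both isomorphic to W.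

    For a direction u = (a : b) of F^2, let A_u be the subgroup of the elements
    lying over W (x) u ([atom]); it has order q^6.  Two vectors w (x) u and
    w' (x) u' commute for all w and w' as soon as s(u, u') = 0, so the
    subgroups A_(a : b) and A_(b : a) centralise each other, and A_u is abelian
    iff u is isotropic, i.e. a^2 = b^2.  The q + 1 directions give q + 1
    subgroups, and the isotropic ones are (1 : 1) and (1 : -1), which coincide
    exactly in characteristic two.

    It remains to see that the subgroups U with |U| |C(U)| >= q^12 are Y, its
    centre Z, and the A_u, and that equality holds for these
    ([cd_classification]).  Call an element collinear if its x and y are
    proportional, that is, if it lies over a pure tensor w (x) u.
    - A non-collinear element g has a centraliser of order at most q^6, and only
      q^4 elements commute with the whole of C(g).  If both U and C(U) contain
      non-collinear elements, both have order at most q^6, and they cannot both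
      have order q^6 ([card_pair_noncollinear]).
    - Otherwise one of U and C(U) consists of collinear elements.  A group of
      such elements lies over some W (x) u or some w (x) F^2, and in each case
      the centraliser is small enough, the bound q^12 being attained only by the
      pairs (Z, Y) and (A_(a : b), A_(b : a)) ([collinear_pair]).

    All estimates only bound the number of elements by parametrising them by
    vectors over F, so they hold for all subgroups of Y, whether or not they
    correspond to F-subspaces, over every finite field.  The theorem is the case
    F = 'F_p. *)

(** * Recognising a quasi-antichain *)

Section QuasiAntichain.
Variables (gT : finGroupType) (M B : {group gT}) (A : {set {group gT}}).
Hypothesis A0 : A != set0.
Hypothesis AB : forall X : {group gT}, X \in A -> B \proper X.
Hypothesis AM : forall X : {group gT}, X \in A -> X \proper M.
Hypothesis anti : {in A &, forall X X' : {group gT}, X \subset X' -> X = X'}.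
Let L := M |: (B |: A).

Lemma layered_sub : B \proper M.
Proof.
by have [X XA] := set0Pn _ A0; apply: proper_trans (AB XA) (AM XA).
Qed.

Lemma layered_maximum : is_maximum L M.
Proof.
rewrite /is_maximum !inE eqxx; apply/forall_inP=> X.
rewrite !inE => /or3P[/eqP->//|/eqP->|/AM/proper_sub//].
exact: proper_sub layered_sub.
Qed.

Lemma layered_minimum B' : is_minimum L B' = (B' == B).
Proof.
apply/idP/eqP=> [/andP[B'L /forall_inP min]|->]; last first.
  rewrite /is_minimum !inE eqxx orbT; apply/forall_inP=> X.
  rewrite !inE => /or3P[/eqP->|/eqP->//|/AB/proper_sub//].
  exact: proper_sub layered_sub.
have /min sB'B : B \in L by rewrite !inE eqxx orbT.
apply/group_inj/eqP; rewrite eqEsubset sB'B /=.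
move: B'L; rewrite !inE => /or3P[/eqP->|/eqP->//|/AB/proper_sub//].
exact: proper_sub layered_sub.
Qed.

(** Since A is not empty, M lies strictly above some member of A, so it is not an
    atom; the antichain condition makes every member of A minimal above B. *)
Lemma layered_atoms : atoms L = A.
Proof.
apply/setP=> X; rewrite inE; apply/andP/idP=> [[XL /existsP[B' /and3P[]]]|XA].
  rewrite layered_minimum => /eqP-> BX /forall_inP min.
  move: XL; rewrite !inE => /or3P[/eqP eX|/eqP eX|//]; last first.
    by rewrite eX properxx in BX.
  have [X' X'A] := set0Pn _ A0; have := min X'.
  by rewrite !inE X'A !orbT eX AB ?AM // => /(_ isT).
split; first by rewrite !inE XA !orbT.
apply/existsP; exists B; rewrite layered_minimum eqxx AB //=.
apply/forall_inP=> X'; rewrite !inE => /or3P[/eqP->|/eqP->|X'A].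
- by rewrite negb_and [M \proper X]properE (proper_sub (AM XA)) andbF orbT.
- by rewrite properxx.
apply/nandP; right; apply/negP=> pX; have eX := anti X'A XA (proper_sub pX).
by rewrite eX properxx in pX.
Qed.

Lemma layered_quasi_antichain : quasi_antichain L.
Proof.
exists M, B; split; rewrite ?layered_atoms ?layered_minimum ?layered_maximum //.
by apply/negP=> /AM; rewrite properxx.
Qed.

End QuasiAntichain.

(** * The cross product of F^3 *)

Section CrossProduct.
Import GRing.Theory.
Local Open Scope ring_scope.
Variable F : fieldType.
Implicit Types (x y v w : 'rV[F]_3) (a b c : F).

(** The indices 0, 1, 2 are added modulo 3 in the ring of integers mod 3, which
    makes all coordinate arguments invariant under cyclic shifts: only one of
    the three coordinates has to be treated. *)
Definition half_cross x y : 'rV[F]_3 :=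
  \row_(i < 3) (x 0 (i + 1) * y 0 (i + 2)).

Definition cross x y : 'rV[F]_3 := half_cross x y - half_cross y x.

Lemma half_crossDl x x' y :
  half_cross (x + x') y = half_cross x y + half_cross x' y.
Proof. by apply/rowP=> i; rewrite !mxE mulrDl. Qed.

Lemma half_crossDr x y y' :
  half_cross x (y + y') = half_cross x y + half_cross x y'.
Proof. by apply/rowP=> i; rewrite !mxE mulrDr. Qed.

Lemma half_cross0l y : half_cross 0 y = 0.
Proof. by apply/rowP=> i; rewrite !mxE mul0r. Qed.

Lemma half_crossNl x y : half_cross (- x) y = - half_cross x y.
Proof. by apply/rowP=> i; rewrite !mxE mulNr. Qed.

Lemma half_crossZl a x y : half_cross (a *: x) y = a *: half_cross x y.
Proof. by apply/rowP=> i; rewrite !mxE mulrA. Qed.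

Lemma half_crossZr a x y : half_cross x (a *: y) = a *: half_cross x y.
Proof. by apply/rowP=> i; rewrite !mxE mulrCA. Qed.

Lemma crossC x y : cross x y = - cross y x.
Proof. by rewrite /cross opprB. Qed.

Lemma crossvv x : cross x x = 0.
Proof. exact: subrr. Qed.

Lemma cross0l y : cross 0 y = 0.
Proof. by apply/rowP=> i; rewrite !mxE mul0r mulr0 subrr. Qed.

Lemma cross0r x : cross x 0 = 0.
Proof. by rewrite crossC cross0l oppr0. Qed.

Lemma crossDl x x' y : cross (x + x') y = cross x y + cross x' y.
Proof. by rewrite /cross half_crossDl half_crossDr opprD addrACA. Qed.

Lemma crossZl a x y : cross (a *: x) y = a *: cross x y.
Proof. by rewrite /cross half_crossZl half_crossZr scalerBr. Qed.

Lemma crossDr x y y' : cross x (y + y') = cross x y + cross x y'.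
Proof. by rewrite crossC crossDl opprD -!(crossC x). Qed.

Lemma crossZr a x y : cross x (a *: y) = a *: cross x y.
Proof. by rewrite crossC crossZl -scalerN -crossC. Qed.

Definition crossE :=
  (crossDl, crossDr, crossZl, crossZr, crossvv, scaler0, addr0, add0r).

Lemma ord3_cases (i j : 'I_3) : [\/ j = i, j = i + 1 | j = i + 2].
Proof.
case: i j => [[|[|[|//]]] Hi] [[|[|[|//]]] Hj];
 by [constructor 1; apply: val_inj | constructor 2; apply: val_inj
    | constructor 3; apply: val_inj].
Qed.

Lemma row3P i v w :
  v 0 i = w 0 i -> v 0 (i + 1) = w 0 (i + 1) -> v 0 (i + 2) = w 0 (i + 2) ->
  v = w.
Proof. by move=> e0 e1 e2; apply/rowP=> j; case: (ord3_cases i j) => ->. Qed.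

Lemma ord3_shift (i : 'I_3) : (i + 1 + 1 = i + 2) * (i + 1 + 2 = i)
  * (i + 2 + 1 = i) * (i + 2 + 2 = i + 1).
Proof.
by do !split; case: i => [[|[|[|//]]] Hi]; apply: val_inj.
Qed.

Lemma cross_coord x y i :
  cross x y 0 i = x 0 (i + 1) * y 0 (i + 2) - y 0 (i + 1) * x 0 (i + 2).
Proof. by rewrite !mxE. Qed.

Lemma cross_eq0_line w v : w != 0 -> cross w v = 0 -> exists c, v = c *: w.
Proof.
move=> /rV0Pn [i wi0] wv0; exists (v 0 i / w 0 i).
have := cross_coord w v (i + 1); have := cross_coord w v (i + 2).
rewrite wv0 !mxE !ord3_shift => /esym/subr0_eq e1 /esym/subr0_eq e2.
apply: (@row3P i); rewrite mxE.
- by rewrite divfK.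
- by rewrite mulrAC -e1 mulrAC mulfV // mul1r.
- by rewrite mulrAC (mulrC (v 0 i)) e2 mulfK.
Qed.

Definition dot x y : F := \sum_j x 0 j * y 0 j.

Lemma dotE i x y :
  dot x y = x 0 i * y 0 i + x 0 (i + 1) * y 0 (i + 1) + x 0 (i + 2) * y 0 (i + 2).
Proof.
rewrite /dot (bigD1 i) //= (bigD1 (i + 1)) /=; last first.
  by case: i => [[|[|[|//]]] Hi].
rewrite (bigD1 (i + 2)) /=; last by case: i => [[|[|[|//]]] Hi].
rewrite big1 ?addr0 ?addrA // => j /andP[/andP[/eqP n0 /eqP n1] /eqP n2].
by rewrite ord3_shift in n2; case: (ord3_cases i j).
Qed.

Lemma dot_cross_l x y : dot x (cross x y) = 0.
Proof. rewrite (dotE 0) !cross_coord !ord3_shift; ring. Qed.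

Lemma dot_cross_swap x y v : dot y (cross x v) = - dot x (cross y v).
Proof. rewrite !(dotE 0) !cross_coord !ord3_shift; ring. Qed.

(** Cramer's rule: the coefficients of the linear relation between four vectors
    x, y, v and a basis vector are three-by-three determinants, of which those
    involving the basis vector are entries of cross products. *)
Lemma cross_cramer x y v i :
  cross x y 0 i *: v + cross y v 0 i *: x + cross v x 0 i *: y
    = dot x (cross y v) *: delta_mx 0 i.
Proof.
have neq1 : (i + 1 == i) = false by case: i => [[|[|[|//]]] Hi].
have neq2 : (i + 2 == i) = false by case: i {neq1} => [[|[|[|//]]] Hi].
apply: (@row3P i); rewrite (dotE i) !mxE !ord3_shift !eqxx ?neq1 ?neq2 /=; ring.
Qed.

(** Here dot x (cross y v) is the determinant of x, y, v, so that Cramer's rule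
    expresses v through x and y when it vanishes. *)
Lemma coplanar x y v :
  cross x y != 0 -> dot x (cross y v) = 0 -> exists c d, v = c *: y + d *: x.
Proof.
move=> /rV0Pn [i ni0] det0; have := cross_cramer x y v i.
rewrite det0 scale0r -addrA => /addr0_eq E.
exists (- (cross v x 0 i / cross x y 0 i)), (- (cross y v 0 i / cross x y 0 i)).
rewrite -[LHS](scalerK ni0) -[_ *: v]opprK E.
by rewrite scalerN scalerDr !scalerA opprD addrC !scaleNr
  ![(cross x y 0 i)^-1 * _]mulrC.
Qed.

(** The common value of the two products is orthogonal to x and to y, which
    forces x' and y' into the plane spanned by x and y; within that plane the
    equation makes one coefficient of x' opposite to one of y'. *)
Lemma cross_eq_cross x y x' y' :
  cross x y != 0 -> cross x x' = cross y y' ->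
  exists c d e, x' = c *: y + d *: x /\ y' = - c *: x + e *: y.
Proof.
move=> n0 E.
have [|c [d Ex]] := @coplanar x y x' n0.
  by rewrite -[LHS]opprK -dot_cross_swap E dot_cross_l oppr0.
have [|e [c' Ey]] := @coplanar x y y' n0.
  by rewrite -E dot_cross_l.
exists c, d, e; split=> //; rewrite Ey addrC; congr (_ *: x + _).
move/eqP: E; rewrite Ex Ey !crossE (crossC y x) scalerN -scaleNr.
rewrite -subr_eq0 -scalerBl scaler_eq0 (negPf n0) orbF subr_eq0.
by move/eqP->; rewrite opprK.
Qed.

End CrossProduct.

(** * The group of order q^9 *)

Section Group.
Import GRing.Theory.
Local Open Scope ring_scope.
Variable F : finFieldType.
Local Notation V := 'rV[F]_3.
Local Notation q := #|F|.

Definition cross_group : Type := (V * V * V)%type.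
HB.instance Definition _ := Finite.on cross_group.

Implicit Types (g h k : cross_group) (w t : V) (a b c : F).

Definition px g : V := g.1.1.
Definition py g : V := g.1.2.
Definition pz g : V := g.2.

(** Half of the commutator form: using one term of the cross product instead of
    the alternating map itself gives the right commutators in characteristic two
    as well, without dividing by two. *)
Definition cocycle g h : V := half_cross (px g) (px h) - half_cross (py g) (py h).

Definition cg_mul g h : cross_group :=
  (px g + px h, py g + py h, pz g + pz h + cocycle g h).
Definition cg_one : cross_group := (0, 0, 0).
Definition cg_inv g : cross_group := (- px g, - py g, - pz g + cocycle g g).

Fact cg_mulA : associative cg_mul.
Proof.
move=> g h k; rewrite /cg_mul /cocycle /px /py /pz /= !half_crossDl !half_crossDr.
congr (_, _, _); rewrite ?addrA //; apply/rowP=> i; rewrite !mxE; ring.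
Qed.

Fact cg_mul1 : left_id cg_one cg_mul.
Proof.
move=> [[x y] z]; rewrite /cg_mul /cocycle /px /py /pz /=.
by rewrite !half_cross0l subrr !add0r addr0.
Qed.

Fact cg_mulV : left_inverse cg_one cg_inv cg_mul.
Proof.
move=> [[x y] z]; rewrite /cg_mul /cocycle /px /py /pz /=.
congr (_, _, _); rewrite ?addNr // !half_crossNl.
apply/rowP=> i; rewrite !mxE; ring.
Qed.

HB.instance Definition _ := Finite_isGroup.Build cross_group cg_mulA cg_mul1 cg_mulV.

Lemma mulE g h : (g * h)%g = cg_mul g h. Proof. by []. Qed.
Lemma pxM g h : px (g * h)%g = px g + px h. Proof. by []. Qed.
Lemma pyM g h : py (g * h)%g = py g + py h. Proof. by []. Qed.
Lemma px1 : px 1%g = 0. Proof. by []. Qed.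
Lemma py1 : py 1%g = 0. Proof. by []. Qed.

Lemma commuteP g h :
  commute g h <-> cross (px g) (px h) = cross (py g) (py h).
Proof.
rewrite /commute !mulE /cg_mul /cocycle /cross.
split=> [[_ _ /rowP E]|/rowP E].
  apply/rowP=> i; move: (E i); rewrite !mxE => /eqP; rewrite -subr_eq0 => /eqP E0.
  by apply/eqP; rewrite -subr_eq0 -E0; apply/eqP; ring.
congr (_, _, _); [exact: addrC|exact: addrC|].
apply/rowP=> i; move: (E i); rewrite !mxE => /eqP; rewrite -subr_eq0 => /eqP E0.
by apply/eqP; rewrite -subr_eq0 -E0; apply/eqP; ring.
Qed.

Lemma commute_cross (U D : {set cross_group}) g h :
  D \subset 'C(U)%g -> g \in U -> h \in D ->
  cross (px g) (px h) = cross (py g) (py h).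
Proof. by move=> /subsetP sDC gU /sDC /centP /(_ g gU) /esym /commuteP. Qed.

Lemma cent1_cross g h :
  h \in 'C[g]%g -> cross (px g) (px h) = cross (py g) (py h).
Proof. by move/cent1P/esym/commuteP. Qed.

Definition cg_center : {set cross_group} := [set g | (px g == 0) && (py g == 0)].
Fact cg_center_group : group_set cg_center.
Proof.
apply/group_setP; split=> [|g h]; rewrite !inE ?px1 ?py1 ?eqxx //.
by move=> /andP[/eqP xg /eqP yg] /andP[/eqP xh /eqP yh]; rewrite pxM pyM xg yg xh yh addr0 eqxx.
Qed.
Canonical cg_center_groupType := Group cg_center_group.

(** The subgroup A_(a : b) over W (x) (a, b), described by an equation so that it
    is a subgroup without any condition; for a = b = 0 it is the whole group, and
    therefore the statements below ask for (a, b) to be nonzero. *)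
Definition atom a b : {set cross_group} := [set g | b *: px g == a *: py g].
Fact atom_group a b : group_set (atom a b).
Proof.
apply/group_setP; split=> [|g h]; rewrite !inE ?px1 ?py1 ?scaler0 ?eqxx //.
by move=> /eqP eg /eqP eh; rewrite pxM pyM !scalerDr eg eh.
Qed.
Canonical atom_groupType a b := Group (atom_group a b).

Lemma card_row3 : #|{: V}| = (q ^ 3)%N. Proof. by rewrite card_mx. Qed.

Lemma card_cross_group : #|[set: cross_group]| = (q ^ 9)%N.
Proof. by rewrite cardsT !card_prod card_row3 -!expnD. Qed.

Lemma card_cg_center : #|cg_center| = (q ^ 3)%N.
Proof.
have inj : injective (fun z : V => (0, 0, z) : cross_group) by move=> z z' [].
rewrite -card_row3 -(card_imset _ inj); congr #|pred_of_set _|; apply/setP=> -[[x y] z].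
rewrite inE /px /py /=; apply/andP/imsetP=> [[/eqP-> /eqP->]|[z' _ [-> -> _]]] //.
by exists z.
Qed.

Lemma bezout a b : (a, b) != (0, 0) -> exists a0 b0, a * a0 + b * b0 = 1.
Proof.
have [-> /= b0|a0 _] := eqVneq a 0; last by exists a^-1, 0; rewrite mulr0 addr0 mulfV.
have {}b0 : b != 0 by apply: contraNneq b0 => ->.
by exists 0, b^-1; rewrite mul0r add0r mulfV.
Qed.

Lemma atomP a b g : (a, b) != (0, 0) ->
  reflect (exists t, px g = a *: t /\ py g = b *: t) (g \in atom a b).
Proof.
move=> ab0; rewrite inE; apply: (iffP eqP) => [E|[t [-> ->]]]; last first.
  by rewrite !scalerA mulrC.
have [a0 [b0 ab1]] := bezout ab0.
exists (a0 *: px g + b0 *: py g); rewrite !scalerDr !scalerA; split.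
  by rewrite [a * b0]mulrC -[(b0 * a) *: _]scalerA -E scalerA -scalerDl [b0 * b]mulrC ab1 scale1r.
by rewrite [b * a0]mulrC -[(a0 * b) *: _]scalerA E scalerA -scalerDl [a0 * a]mulrC ab1 scale1r.
Qed.

Lemma card_atom a b : (a, b) != (0, 0) -> #|atom a b| = (q ^ 6)%N.
Proof.
move=> ab0; have [a0 [b0 ab1]] := bezout ab0.
pose f (tz : V * V) : cross_group := (a *: tz.1, b *: tz.1, tz.2).
have inj : injective f.
  move=> [t z] [t' z'] [/= Ea Eb ->]; congr (_, _).
  rewrite -[t]scale1r -[t']scale1r -ab1 !scalerDl ![_ * a0]mulrC ![_ * b0]mulrC.
  by rewrite -!scalerA Ea Eb.
rewrite -[RHS](_ : #|{: V * V}| = _); last by rewrite card_prod card_row3 -expnD.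
rewrite -(card_imset _ inj); congr #|pred_of_set _|; apply/setP=> -[[x y] z].
apply/(atomP _ ab0)/imsetP=> [[t []]|[[t z'] _ [-> -> _]]]; last by exists t.
by rewrite /px /py /= => -> ->; exists (t, z).
Qed.

Lemma card_le_param (T K : finType) (f : K -> T) (A : {pred T}) :
  (forall u, u \in A -> exists v, u = f v) -> (#|A| <= #|K|)%N.
Proof.
move=> fA; apply: leq_trans (leq_image_card f K).
by apply/subset_leq_card/subsetP=> u /fA[k ->]; apply: codom_f.
Qed.

Lemma cent_cg_center : cg_center \subset 'C([set: cross_group])%g.
Proof.
apply/centsP=> g; rewrite inE => /andP[/eqP xg /eqP yg] h _; apply/commuteP.
by rewrite xg yg !cross0l.
Qed.

(** The directions (a, b) and (b, a) are orthogonal for the form a a' - b b'. *)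
Lemma cent_atom a b : (a, b) != (0, 0) -> atom b a \subset 'C(atom a b)%g.
Proof.
move=> ab0; have ba0 : (b, a) != (0, 0) by apply: contraNneq ab0 => -[-> ->].
apply/centsP=> g /(atomP _ ba0)[t [xg yg]] h /(atomP _ ab0)[t' [xh yh]].
by apply/commuteP; rewrite xg yg xh yh !crossE !scalerA mulrC.
Qed.

(** * Non-collinear elements *)

(** By [cross_eq_cross], x' and y' depend on only three scalars. *)
Lemma card_cent1_noncollinear g :
  cross (px g) (py g) != 0 -> (#|'C[g]%g| <= q ^ 6)%N.
Proof.
(* The scalars c, d, e of [cross_eq_cross] and the central coordinate. *)
move=> n0; pose f (k : F * F * F * V) : cross_group :=
  (k.1.1.1 *: py g + k.1.1.2 *: px g, - k.1.1.1 *: px g + k.1.2 *: py g, k.2).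
have := @card_le_param _ _ f 'C[g]%g.
rewrite !card_prod card_row3 -!mulnA -!expnS; apply=> -[[x y] z].
move=> /cent1_cross /(cross_eq_cross n0)[c [d [e [Ex Ey]]]].
by exists (c, d, e, z); rewrite /f /= -Ex -Ey.
Qed.

(** The centraliser of g = (x, y) contains (x, 0), (0, y) and (y, -x).  Commuting
    with the first two confines an element to multiples c x and d y, and
    commuting with the third gives c = d. *)
Lemma card_cent_cent1_noncollinear g (U : {set cross_group}) :
  cross (px g) (py g) != 0 -> 'C[g]%g \subset 'C(U)%g -> (#|U| <= q ^ 4)%N.
Proof.
move=> n0 sgU.
pose f (k : F * V) : cross_group := (k.1 *: px g, k.1 *: py g, k.2).
have px0 : px g != 0 by apply: contraNneq n0 => ->; rewrite cross0l.
have py0 : py g != 0 by apply: contraNneq n0 => ->; rewrite cross0r.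
have := @card_le_param _ _ f U.
rewrite card_prod card_row3 -expnS; apply=> -[[x y] z] hU.
have key x' y' : cross (px g) x' = cross (py g) y' -> cross x x' = cross y y'.
  move=> E; apply: (@commute_cross U 'C[g]%g (x, y, z) (x', y', 0)) => //.
  by apply/cent1P/esym/commuteP.
have [|c Ex] := @cross_eq0_line _ (px g) x px0.
  by rewrite crossC (key (px g) 0) ?cross0r ?oppr0 ?crossvv.
have [|d Ey] := @cross_eq0_line _ (py g) y py0.
  by rewrite crossC -(key 0 (py g)) ?cross0r ?oppr0 ?crossvv.
exists (c, z); congr (_, _, _) => //=; rewrite Ey; congr (_ *: _); apply/eqP.
(* The element (y, -x) commutes with g, and tells c from d. *)
have E : cross (px g) (py g) = cross (py g) (- px g).
  by rewrite -scaleN1r crossZr scaleN1r -crossC.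
have := key _ _ E; rewrite Ex Ey !crossZl -E => /eqP.
by rewrite -subr_eq0 -scalerBl scaler_eq0 (negPf n0) orbF subr_eq0 eq_sym.
Qed.

(** Both orders are at most q^6.  If D reaches the order of C[g], then D = C[g]
    and U is confined to the q^4 elements that commute with C[g]; otherwise the
    bound on |D| is strict. *)
Lemma card_pair_noncollinear (U D : {group cross_group}) g h :
  D \subset 'C(U)%g -> g \in U -> h \in D ->
  cross (px g) (py g) != 0 -> cross (px h) (py h) != 0 ->
  (#|U| * #|D| < q ^ 12)%N.
Proof.
move=> sDC gU hD ng nh; have q1 : (1 < q)%N := card_finNzRing_gt1 F.
have sDg : D \subset 'C[g]%g.
  by rewrite -cent_set1; apply: subset_trans sDC _; rewrite centS // sub1set.
have sUh : U \subset 'C[h]%g.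
  rewrite -cent_set1; apply: subset_trans (_ : 'C(D) \subset _)%g; first by rewrite centsC.
  by rewrite centS // sub1set.
have leU := leq_trans (subset_leq_card sUh) (card_cent1_noncollinear nh).
have leD := subset_leq_card sDg.
have leg := card_cent1_noncollinear ng.
have [ltD|geD] := ltnP #|D| #|'C[g]%g|.
  rewrite -[12%N]/(6 + 6)%N expnD.
  apply: leq_ltn_trans (leq_mul leU (leqnn _)) _.
  by rewrite ltn_pmul2l ?expn_gt0 ?(ltnW q1) // (leq_trans ltD).
have eD : D :=: 'C[g]%g by apply/eqP; rewrite eqEcard sDg.
have le4 : (#|U| <= q ^ 4)%N.
  by apply: (card_cent_cent1_noncollinear ng); rewrite -eD.
apply: leq_ltn_trans (leq_mul le4 (leq_trans leD leg)) _.
by rewrite -expnD ltn_exp2l.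
Qed.

(** * Collinear subgroups *)

Definition collinear (R : {set cross_group}) := forall g, g \in R -> cross (px g) (py g) = 0.

(** The condition of collinearity is a quadratic equation, and a subgroup of
    solutions satisfies the polarised equation too. *)
Lemma collinear_polar (R : {group cross_group}) g h :
  collinear R -> g \in R -> h \in R -> cross (px g) (py h) = cross (py g) (px h).
Proof.
move=> colR gR hR; have := colR _ (groupM gR hR).
rewrite pxM pyM !crossE !colR // addr0 add0r => /eqP.
by rewrite addr_eq0 => /eqP ->; rewrite -crossC.
Qed.

Lemma collinear_point (R : {group cross_group}) :
  collinear R -> ~~ (R \subset cg_center) ->
  exists g a b w, [/\ g \in R, (a, b) != (0, 0), w != 0, px g = a *: w & py g = b *: w].
Proof.
move=> colR /subsetPn[g gR]; rewrite inE negb_and => n0; exists g.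
have [x0|x0] := eqVneq (px g) 0; last first.
  have [b Eb] := cross_eq0_line x0 (colR g gR).
  by exists 1, b, (px g); rewrite scale1r; split=> //; rewrite xpair_eqE oner_eq0.
move: n0; rewrite x0 eqxx /= => y0.
by exists 0, 1, (py g); rewrite scale0r scale1r; split=> //; rewrite xpair_eqE oner_eq0 andbF.
Qed.

(** Applied to the cross products of w with x and y, this says that (x, y) lies
    over w (x) F^2 as soon as its contractions along two independent directions
    are multiples of w. *)
Lemma eq0_of_independent_relations (a b a' b' : F) w w' :
  a * b' != b * a' -> a *: w' = b *: w -> a' *: w' = b' *: w -> w = 0 /\ w' = 0.
Proof.
move=> d0 E E'; have d1 : a * b' - b * a' != 0 by rewrite subr_eq0.
split; apply/eqP.
  have : (a * b' - b * a') *: w = 0.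
    rewrite scalerBl -scalerA -E' [b * _]mulrC -[(a' * b) *: _]scalerA -E !scalerA.
    by rewrite mulrC subrr.
  by move/eqP; rewrite scaler_eq0 (negPf d1).
have : (a * b' - b * a') *: w' = 0.
  rewrite scalerBl -[(b * _) *: _]scalerA E' [a * _]mulrC -scalerA E !scalerA.
  by rewrite mulrC subrr.
by move/eqP; rewrite scaler_eq0 (negPf d1).
Qed.

(** The bound for the subgroups over w (x) F^2. *)
Lemma card_on_line w (U : {set cross_group}) :
  w != 0 ->
  (forall h, h \in U -> cross w (px h) = 0 /\ cross w (py h) = 0) ->
  (#|U| <= q ^ 5)%N.
Proof.
move=> w0 hU.
have := @card_le_param _ _ (fun k : F * F * V => (k.1.1 *: w, k.1.2 *: w, k.2) : cross_group) U.
rewrite !card_prod card_row3 -!mulnA -!expnS; apply=> -[[x y] z] /hU[].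
move=> /(cross_eq0_line w0)[c Ex] /(cross_eq0_line w0)[d Ey].
by exists (c, d, z); rewrite /= -Ex -Ey.
Qed.

(** For g over w (x) (a, b), commuting with g depends only on the contraction
    a x - b y of the other element along the direction (a, b). *)
Lemma cross_point g h a b w :
  cross (px g) (px h) = cross (py g) (py h) -> px g = a *: w -> py g = b *: w ->
  cross w (a *: px h - b *: py h) = 0.
Proof.
move=> E Eg Eg'; move: E; rewrite Eg Eg' !crossZl => E.
by rewrite crossDr -scaleNr !crossZr E scaleNr subrr.
Qed.

(** The contraction along (a, b) must be a multiple of w, which leaves one scalar
    for it and a free vector for a complementary contraction. *)
Lemma card_cent_point g a b w (Q : {set cross_group}) :
  (a, b) != (0, 0) -> w != 0 -> px g = a *: w -> py g = b *: w ->
  (forall h, h \in Q -> cross (px g) (px h) = cross (py g) (py h)) ->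
  (#|Q| <= q ^ 7)%N.
Proof.
move=> ab0 w0 Eg Eg' cQ; have [a0 [b0 ab1]] := bezout ab0.
have := @card_le_param _ _ (fun k : F * V * V =>
  (* The vectors x and y are recovered from the contraction a x - b y = c w and
     from b0 x + a0 y, because a a0 + b b0 = 1. *)
  (a0 * k.1.1 *: w + b *: k.1.2, a *: k.1.2 - b0 * k.1.1 *: w, k.2) : cross_group) Q.
rewrite !card_prod card_row3 -expnS -expnD; apply=> -[[x y] z] /cQ E.
have [c Ec] := cross_eq0_line w0 (cross_point E Eg Eg').
exists (c, b0 *: x + a0 *: y, z); rewrite /= -!scalerA -Ec /px /py /=.
have Dx : x = (a * a0 + b * b0) *: x by rewrite ab1 scale1r.
have Dy : y = (a * a0 + b * b0) *: y by rewrite ab1 scale1r.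
congr (_, _, _); [rewrite {1}Dx|rewrite {1}Dy];
  by apply/rowP=> i; rewrite !mxE; ring.
Qed.

Lemma card_mul_lt (m n i j : nat) :
  (m <= q ^ i)%N -> (n <= q ^ j)%N -> (i + j < 12)%N -> (q ^ 12 <= m * n)%N -> False.
Proof.
move=> lem len ij /leq_trans/(_ (leq_mul lem len)).
by rewrite -expnD leq_exp2l ?card_finNzRing_gt1 // leqNgt ij.
Qed.

Lemma card_mul_eq (m n i j : nat) :
  (m <= q ^ i)%N -> (n <= q ^ j)%N -> (i + j = 12)%N -> (q ^ 12 <= m * n)%N ->
  (q ^ i <= m)%N /\ (q ^ j <= n)%N.
Proof.
have q0 : (0 < q)%N by rewrite ltnW ?card_finNzRing_gt1.
move=> lem len <-; rewrite expnD => le; split.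
  by rewrite -(leq_pmul2r (_ : 0 < q ^ j)%N) ?expn_gt0 ?q0 // (leq_trans le) ?leq_mul.
by rewrite -(leq_pmul2l (_ : 0 < q ^ i)%N) ?expn_gt0 ?q0 // (leq_trans le) ?leq_mul.
Qed.

(** If R is central, the pair can only be (Z, Y).  Otherwise R has an element
    over w (x) (a, b) with w and (a, b) nonzero.  If R contains an element over
    another direction, polarisation forces R and Q over w (x) F^2, and both
    orders are at most q^5.  If R lies over the single direction (a, b), either
    it lies over the line of w, with orders at most q^4 and q^7, or it involves
    two independent vectors, which forces Q into A_(b : a), and the orders are
    at most q^6 each. *)
Lemma collinear_pair (R Q : {group cross_group}) :
  collinear R -> Q \subset 'C(R)%g -> (q ^ 12 <= #|R| * #|Q|)%N ->
  R :=: cg_center /\ Q :=: [set: cross_group] \/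
  exists a b, [/\ (a, b) != (0, 0), R :=: atom a b & Q :=: atom b a].
Proof.
move=> colR cQ le12.
have [sRZ|nRZ] := boolP (R \subset cg_center).
  left; have lR := subset_leq_card sRZ; rewrite card_cg_center in lR.
  have lQ := subset_leq_card (subsetT Q); rewrite card_cross_group in lQ.
  have [gR gQ] := card_mul_eq lR lQ erefl le12.
  by split; apply/eqP; rewrite eqEcard ?sRZ ?subsetT ?card_cg_center ?card_cross_group.
have [g [a [b [w [gR ab0 w0 Eg Eg']]]]] := collinear_point colR nRZ.
have cgQ h : h \in Q -> cross w (a *: px h - b *: py h) = 0.
  by move=> hQ; exact: (cross_point (commute_cross cQ gR hQ) Eg Eg').
have cgR h : h \in R -> cross w (a *: py h - b *: px h) = 0.
  move=> hR; have := collinear_polar colR gR hR; rewrite Eg Eg' !crossZl => E.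
  by rewrite crossDr -scaleNr !crossZr E scaleNr subrr.
have [/forall_inP Rdir|] := boolP [forall h in R, h \in atom a b]; last first.
  case/forall_inPn=> h hR; rewrite inE eq_sym -subr_eq0 => n0; exfalso.
  have [c Ec] := cross_eq0_line w0 (cgR h hR).
  have c0 : c != 0 by apply: contraNneq n0 => c0; rewrite Ec c0 scale0r.
  (* Since a y - b x = c w and x is parallel to y, both x and y are multiples of w:
     h lies over w (x) (a', b') for a direction independent of (a, b). *)
  have [X0 Y0] : cross w (px h) = 0 /\ cross w (py h) = 0.
    have Ex : c *: cross w (px h) = a *: cross (py h) (px h).
      by rewrite -crossZl -Ec crossDl -scaleNr !crossZl crossvv scaler0 addr0.
    have Ey : c *: cross w (py h) = - b *: cross (px h) (py h).
      by rewrite -crossZl -Ec crossDl -scaleNr !crossZl crossvv scaler0 add0r.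
    move/eqP: Ex; move/eqP: Ey; rewrite (crossC (py h)) (colR h hR) oppr0 !scaler0.
    by rewrite !scaler_eq0 (negPf c0) /= => /eqP-> /eqP->.
  have [a' Ea'] := cross_eq0_line w0 X0; have [b' Eb'] := cross_eq0_line w0 Y0.
  have d0 : a * b' != b * a'.
    by apply: contraNneq n0 => E; rewrite Ea' Eb' !scalerA E subrr.
  have lR : (#|R| <= q ^ 5)%N.
    apply: (card_on_line w0) => k kR; apply: (eq0_of_independent_relations d0).
      apply/eqP; rewrite -subr_eq0 -!crossZr -scaleN1r -crossZr scaleN1r -crossDr.
      by rewrite cgR.
    have := collinear_polar colR hR kR; rewrite Ea' Eb' !crossZl => ->.
    by [].
  have lQ : (#|Q| <= q ^ 5)%N.
    apply: (card_on_line w0) => k kQ; apply/and_comm; apply: (eq0_of_independent_relations d0).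
      apply/eqP; rewrite -subr_eq0 -!crossZr -scaleN1r -crossZr scaleN1r -crossDr.
      by rewrite cgQ.
    by have := commute_cross cQ hR kQ; rewrite Ea' Eb' !crossZl => ->.
  exact: card_mul_lt lR lQ _ le12.
right; exists a, b.
have sRA : R \subset atom a b by apply/subsetP.
have ba0 : (b, a) != (0, 0) by apply: contraNneq ab0 => -[-> ->].
have [/forall_inP Rline|] :=
  boolP [forall h in R, (cross w (px h) == 0) && (cross w (py h) == 0)].
  exfalso.
  have lR : (#|R| <= q ^ 4)%N.
    have := @card_le_param _ _ (fun k : F * V => (a * k.1 *: w, b * k.1 *: w, k.2) : cross_group) R.
    rewrite !card_prod card_row3 -!expnS; apply=> h hR.
    have /andP[/eqP X0 /eqP Y0] := Rline h hR.
    have /(atomP _ ab0)[t [Ex Ey]] := Rdir h hR.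
    have [|c Ec] := @cross_eq0_line _ w t w0.
      have [a0 [b0 ab1]] := bezout ab0.
      rewrite -[LHS]scale1r -ab1 scalerDl mulrC [b * _]mulrC -!scalerA -!crossZr -Ex -Ey.
      by rewrite !crossZr X0 Y0 !scaler0 addr0.
    exists (c, pz h); case: h Ex Ey {hR X0 Y0} => [[x y] z].
    by rewrite /px /py /= -!scalerA -Ec => -> ->.
  have lQ : (#|Q| <= q ^ 7)%N.
    by apply: (card_cent_point ab0 w0 Eg Eg') => h hQ; exact: (commute_cross cQ gR hQ).
  exact: card_mul_lt lR lQ _ le12.
(* Here h lies over t (x) (a, b) with t independent of w, and the contraction
   along (a, b) of an element of Q is a multiple of both t and w. *)
case/forall_inPn=> h hR n0.
have /(atomP _ ab0)[t [Ex Ey]] := Rdir h hR.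
have t0 : cross t w != 0.
  apply: contraNneq n0 => E.
  by rewrite Ex Ey !crossZr [cross w t]crossC E oppr0 !scaler0 eqxx.
have sQA : Q \subset atom b a.
  apply/subsetP=> k kQ; rewrite inE -subr_eq0.
  have [c Ec] := cross_eq0_line w0 (cgQ k kQ).
  have := cross_point (commute_cross cQ hR kQ) Ex Ey.
  rewrite Ec crossZr => /eqP; rewrite scaler_eq0 (negPf t0) orbF => /eqP->.
  by rewrite scale0r.
have lR := subset_leq_card sRA; have lQ := subset_leq_card sQA.
rewrite card_atom // in lR; rewrite card_atom // in lQ.
have [gR' gQ'] := card_mul_eq lR lQ erefl le12.
by split=> //; apply/eqP; rewrite eqEcard ?sRA ?sQA !card_atom.
Qed.

(** * The Chermak-Delgado lattice *)

(** [collinear_pair] applies to U or to D, the roles being symmetric, unless both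
    contain non-collinear elements. *)
Lemma cd_classification (U D : {group cross_group}) :
  D \subset 'C(U)%g -> (q ^ 12 <= #|U| * #|D|)%N ->
  (#|U| * #|D|)%N = (q ^ 12)%N /\
  [\/ U :=: cg_center, U :=: [set: cross_group] |
      exists a b, (a, b) != (0, 0) /\ U :=: atom a b].
Proof.
move=> cD le12.
have swap a b : (a, b) != (0, 0) :> F * F -> (b, a) != (0, 0) :> F * F.
  by apply: contraNneq => -[-> ->].
have [/forall_inP colU|/forall_inPn[g gU ng]] :=
  boolP [forall g in U, cross (px g) (py g) == 0].
  have colU' : collinear U by move=> g /colU/eqP.
  have [[-> ->]|[a [b [ab0 -> ->]]]] := collinear_pair colU' cD le12.
    by rewrite card_cg_center card_cross_group -expnD; split; last constructor 1.
  have ba0 := swap _ _ ab0; rewrite !card_atom // -expnD; split=> //.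
  by constructor 3; exists a, b.
have [/forall_inP colD|/forall_inPn[h hD nh]] :=
  boolP [forall h in D, cross (px h) (py h) == 0].
  have colD' : collinear D by move=> h /colD/eqP.
  rewrite mulnC in le12; rewrite centsC in cD.
  have [[-> ->]|[a [b [ab0 -> ->]]]] := collinear_pair colD' cD le12.
    by rewrite card_cg_center card_cross_group -expnD; split; last constructor 2.
  have ba0 := swap _ _ ab0; rewrite !card_atom // -expnD; split=> //.
  by constructor 3; exists b, a.
by have := card_pair_noncollinear cD gU hD ng nh; rewrite ltnNge le12.
Qed.

(** The projective line over F is encoded as F with one point added, [Some t]
    being the direction (1 : t) and [None] the direction (0 : 1). *)
Definition direction_atom (s : option F) : {group cross_group} :=
  if s is Some t then atom_groupType 1 t else atom_groupType 0 1.

Lemma atom_direction a b :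
  (a, b) != (0, 0) -> exists s, atom a b = direction_atom s.
Proof.
have [-> /= b0|a0 _] := eqVneq a 0.
  have {}b0 : b != 0 by apply: contraNneq b0 => ->.
  exists None; apply/setP=> g; rewrite !inE !scale0r scale1r scaler_eq0.
  by rewrite (negPf b0).
exists (Some (b / a)); apply/setP=> g; rewrite !inE scale1r.
by rewrite -[RHS](inj_eq (scalerI a0)) scalerA mulrCA mulfV // mulr1.
Qed.

Lemma direction_atomE s : exists a b,
  [/\ (a, b) != (0, 0), direction_atom s :=: atom a b
    & abelian (direction_atom s) = abelian (atom a b)].
Proof.
case: s => [t|]; [exists 1, t | exists 0, 1];
 by split; rewrite // xpair_eqE oner_eq0 ?andbF.
Qed.

Lemma atom_sub a b a' b' : atom a b \subset atom a' b' -> b' * a = a' * b.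
Proof.
pose w : V := const_mx 1.
have w0 : w != 0 by apply/rV0Pn; exists 0; rewrite mxE oner_eq0.
have gA : ((a *: w, b *: w, 0) : cross_group) \in atom a b.
  by rewrite inE !scalerA mulrC.
move/subsetP/(_ _ gA); rewrite inE /px /py /= !scalerA -subr_eq0 -scalerBl.
by rewrite scaler_eq0 (negPf w0) orbF subr_eq0 => /eqP.
Qed.

Lemma direction_atom_sub s s' :
  direction_atom s \subset direction_atom s' -> s = s'.
Proof.
case: s s' => [t|] [t'|] //= /atom_sub /eqP;
  rewrite ?mulr1 ?mul1r ?mulr0 ?mul0r ?oner_eq0 // ?[0 == 1]eq_sym ?oner_eq0 //.
by move/eqP->.
Qed.

(** If A_(a : b) is abelian, comparing the elements over the first two basis
    vectors, whose cross product has an entry equal to 1, gives a^2 = b^2. *)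
Lemma abelian_atom a b :
  (a, b) != (0, 0) -> abelian (atom a b) = (a ^+ 2 == b ^+ 2).
Proof.
move=> ab0; apply/idP/eqP=> [abA|E].
  pose w : V := delta_mx 0 0; pose w' : V := delta_mx 0 1.
  pose g v : cross_group := (a *: v, b *: v, 0).
  have gA v : g v \in atom a b by rewrite inE !scalerA mulrC.
  have := commute_cross abA (gA w) (gA w').
  rewrite /px /py /= !crossE !scalerA => /rowP/(_ 2).
  by rewrite !mxE /= !mulr1 !mulr0 !subr0 !mulr1.
apply/centsP=> g /(atomP _ ab0)[t [xg yg]] h /(atomP _ ab0)[t' [xh yh]].
by apply/commuteP; rewrite xg yg xh yh !crossE !scalerA -!expr2 E.
Qed.

Let Y : {group cross_group} := [set: cross_group]%G.
Let Z : {group cross_group} := cg_center_groupType.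

Lemma cd_measure_setT (U : {group cross_group}) :
  cd_measure Y U = (#|U| * #|'C(U)%g|)%N.
Proof. by rewrite /cd_measure setTI. Qed.

Lemma cd_measure_ge (U D : {group cross_group}) :
  D \subset 'C(U)%g -> (#|U| * #|D| <= cd_measure Y U)%N.
Proof. by move=> cD; rewrite cd_measure_setT leq_mul // subset_leq_card. Qed.

Lemma cd_measure_maximal (U : {group cross_group}) :
  (q ^ 12 <= cd_measure Y U)%N =
  (U \in Y |: (Z |: [set direction_atom s | s : option F])).
Proof.
apply/idP/idP.
  rewrite cd_measure_setT => le12; rewrite !inE.
  have [_ [eU|eU|[a [b [/atom_direction[s es] eU]]]]] := cd_classification (subxx _) le12.
  - by apply/or3P; constructor 2; apply/eqP/group_inj.
  - by apply/or3P; constructor 1; apply/eqP/group_inj.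
  apply/or3P; constructor 3; apply/imsetP; exists s => //; apply/group_inj.
  by rewrite eU es.
rewrite !inE => /or3P[/eqP->|/eqP->|/imsetP[s _ ->]].
- apply: leq_trans (cd_measure_ge cent_cg_center).
  by rewrite card_cross_group card_cg_center -expnD.
- have cYZ : Y \subset 'C(Z)%g by rewrite centsC cent_cg_center.
  apply: leq_trans (cd_measure_ge cYZ).
  by rewrite card_cross_group card_cg_center -expnD.
have [a [b [ab0 eU _]]] := direction_atomE s.
have ba0 : (b, a) != (0, 0) by apply: contraNneq ab0 => -[-> ->].
have cD : atom b a \subset 'C(direction_atom s)%g by rewrite eU cent_atom.
by apply: leq_trans (cd_measure_ge cD); rewrite eU !card_atom // -expnD.
Qed.

Lemma cd_max_cross_group : cd_max Y = (q ^ 12)%N.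
Proof.
apply/eqP; rewrite eqn_leq; apply/andP; split.
  apply/bigmax_leqP=> U _; rewrite cd_measure_setT leqNgt; apply/negP=> lt12.
  by have [E _] := cd_classification (subxx _) (ltnW lt12); rewrite E ltnn in lt12.
apply: leq_trans (leq_bigmax_cond _ (subxx Y)).
by rewrite cd_measure_maximal !inE eqxx.
Qed.

Lemma cd_lattice_cross_group :
  cd_lattice Y = Y |: (Z |: [set direction_atom s | s : option F]).
Proof.
apply/setP=> U; rewrite inE subsetT -cd_measure_maximal -cd_max_cross_group eqn_leq.
by rewrite (leq_bigmax_cond _ (subsetT U)).
Qed.

Lemma direction_atom_inj : injective direction_atom.
Proof. by move=> s s' E; apply: direction_atom_sub; rewrite E. Qed.

Let q1 : (1 < q)%N := card_finNzRing_gt1 F.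

Lemma direction_atoms0 : [set direction_atom s | s : option F] != set0.
Proof. by apply/set0Pn; exists (direction_atom None); apply: imset_f. Qed.

Lemma center_direction_atom (X : {group cross_group}) :
  X \in [set direction_atom s | s : option F] -> Z \proper X.
Proof.
case/imsetP=> s _ ->; have [a [b [ab0 eX _]]] := direction_atomE s.
rewrite properEcard eX card_atom // card_cg_center ltn_exp2l // andbT.
by apply/subsetP=> g; rewrite !inE => /andP[/eqP-> /eqP->]; rewrite !scaler0.
Qed.

Lemma direction_atom_proper (X : {group cross_group}) :
  X \in [set direction_atom s | s : option F] -> X \proper Y.
Proof.
case/imsetP=> s _ ->; have [a [b [ab0 eX _]]] := direction_atomE s.
by rewrite properEcard subsetT eX card_atom // card_cross_group ltn_exp2l.
Qed.

Lemma direction_atoms_antichain :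
  {in [set direction_atom s | s : option F] &,
    forall X X' : {group cross_group}, X \subset X' -> X = X'}.
Proof.
by move=> _ _ /imsetP[s _ ->] /imsetP[s' _ ->] /direction_atom_sub->.
Qed.

Lemma atoms_cross_group :
  atoms (cd_lattice Y) = [set direction_atom s | s : option F].
Proof.
rewrite cd_lattice_cross_group; apply: layered_atoms.
- exact: direction_atoms0.
- exact: center_direction_atom.
- exact: direction_atom_proper.
- exact: direction_atoms_antichain.
Qed.

(** There are q + 1 atoms, one for each point of the projective line. *)
Lemma cd_cross_group_quasi_antichain :
  quasi_antichain_of_width (cd_lattice Y) q.+1.
Proof.
split; last first.
  by rewrite atoms_cross_group card_imset ?card_option //; exact: direction_atom_inj.
rewrite cd_lattice_cross_group; apply: layered_quasi_antichain.
- exact: direction_atoms0.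
- exact: center_direction_atom.
- exact: direction_atom_proper.
- exact: direction_atoms_antichain.
Qed.

(** The abelian atoms are the A_(1 : t) with t^2 = 1, so there are one or two of
    them according to whether 1 = -1 in F. *)
Lemma card_abelian_atoms :
  #|abelian_atoms (cd_lattice Y)| = (1 != -1 :> F).+1.
Proof.
rewrite -cards2.
have inj : injective (direction_atom \o Some) by move=> t t' /direction_atom_inj[].
rewrite -(card_imset _ inj); congr #|pred_of_set _|; apply/setP=> X.
rewrite inE atoms_cross_group; apply/andP/imsetP=> [[/imsetP[[t|] _ ->]]|[t]].
- rewrite abelian_atom ?xpair_eqE ?oner_eq0 // expr1n eq_sym sqrf_eq1 => ab.
  by exists t; rewrite // !inE.
- by rewrite abelian_atom ?xpair_eqE ?oner_eq0 ?andbF // expr1n expr0n eq_sym oner_eq0.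
rewrite !inE -sqrf_eq1 => /eqP t1 -> /=; split; first by apply/imsetP; exists (Some t).
by rewrite abelian_atom ?xpair_eqE ?oner_eq0 // expr1n t1.
Qed.

End Group.

Lemma Fp_opp1_neq1 (p : nat) : prime p -> odd p -> (1 != -1 :> 'F_p)%R.
Proof.
move=> p_pr p_odd; rewrite -GRing.subr_eq0 GRing.opprK.
rewrite -(GRing.natrD _ 1 1) -(GRing.dvdn_pcharf (pchar_Fp p_pr)).
apply: contraL p_odd => /(dvdn_leq (ltn0Sn _)).
by case: p p_pr (prime_gt1 p_pr) => [|[|[|p]]].
Qed.

Theorem proposition11 (p : nat) (hp : prime p) :
  exists (gT : finGroupType) (Y : {group gT}),
    [/\ #|Y| = (p ^ 9)%N,
        quasi_antichain_of_width (cd_lattice Y) (p.+1),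
        p = 2 -> #|abelian_atoms (cd_lattice Y)| = 1
      & odd p -> #|abelian_atoms (cd_lattice Y)| = 2].
Proof.
exists (cross_group 'F_p), [set: cross_group 'F_p]%G; split.
- by rewrite card_cross_group card_Fp.
- by rewrite -[in p.+1](card_Fp hp); apply: cd_cross_group_quasi_antichain.
- by move=> p2; rewrite card_abelian_atoms p2.
- by move=> p_odd; rewrite card_abelian_atoms Fp_opp1_neq1.
Qed.
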